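(* Let $G\ge 1$ be an integer, $p\in(0,1)$, and $k\sim\mathrm{Binomial}(G,p)$. Let $g$ be the per-prompt GRPO update on a one-dimensional Bernoulli-logit prompt with success probability $p$ and group size $G$, with $k$ the number of correct responses in the group; that is, $g=g(k)=\frac{\sqrt{k(G-k)}}{G}$ (which is $0$ for $k\in\{0,G\}$). Then $$\mathbb{E}[g]=\frac1G\sum_{k=1}^{G-1}\binom{G}{k}p^k(1-p)^{G-k}\sqrt{k(G-k)}.$$
   Context: A one-dimensional Bernoulli-logit prompt: the parameter is $\theta\in\mathbb{R}$, responses $y_1,\dots,y_G\in\{0,1\}$ are i.i.d. with $\mathbb{P}[y_i=1]=p=1/(1+e^{-\theta})$, rewards are $R_i=y_i$, and the score is $s_i=\frac{d}{d\theta}\log\pi_\theta(y_i)=y_i-p$. The per-prompt GRPO update is $g=\frac1G\sum_{i=1}^G\hat A_i s_i$ with $\hat A_i=(R_i-\mu)/\sigma$, $\mu=\frac1G\sum_jR_j$, $\sigma=\sqrt{\frac1G\sum_j(R_j-\mu)^2}$, and all $\hat A_i=0$ when $\sigma=0$. With $k=\sum_iR_i$ this update equals $g(k)=\sqrt{k(G-k)}/G$. *)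

(* Defs.v *)
(* MathComp / MathComp-Analysis. *)
From mathcomp Require Import all_boot all_order all_algebra.
From mathcomp Require Import all_classical all_reals all_analysis.
Import Order.TTheory GRing.Theory Num.Theory.
Import numFieldNormedType.Exports.

Set Implicit Arguments.
Unset Strict Implicit.
Unset Printing Implicit Defensive.

Local Open Scope classical_set_scope.
Local Open Scope ring_scope.

(* The product rule is required for every subfamily [J] of the finite index
   type, not only for the whole family. *)
Definition mutually_independent d d' (T : measurableType d)
    (T' : measurableType d') (R : realType) (P : probability T R)
    (I : finType) (X : I -> {RV P >-> T'}) : Prop :=
  forall (J : {set I}) (A : I -> set T'),
    (forall i, measurable (A i)) ->
    P (\bigcap_(i in [set` J]) (X i @^-1` A i)) =
    (\prod_(i in J) P (X i @^-1` A i))%E.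

Definition sigmoid (R : realType) (theta : R) : R := (1 + expR (- theta))^-1.

Definition logit_policy (R : realType) (theta : R) (b : bool) : R :=
  bernoulli_pmf (sigmoid theta) b.

Definition score (R : realType) (theta : R) (b : bool) : R :=
  derive1 (fun t : R => ln (logit_policy t b)) theta.

Definition group_mean (R : realType) (G : nat) (r : 'I_G -> R) : R :=
  G%:R^-1 * \sum_(i < G) r i.

Definition group_std (R : realType) (G : nat) (r : 'I_G -> R) : R :=
  Num.sqrt (G%:R^-1 * \sum_(i < G) (r i - group_mean r) ^+ 2).

Definition advantage (R : realType) (G : nat) (r : 'I_G -> R) (i : 'I_G) : R :=
  if group_std r == 0 then 0 else (r i - group_mean r) / group_std r.

(* [r] and [s] are the rewards and the scores of the [G] responses. *)
Definition grpo_update (R : realType) (G : nat) (r s : 'I_G -> R) : R :=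
  G%:R^-1 * \sum_(i < G) advantage r i * s i.

(* A response is its own 0/1 reward. *)
Definition bernoulli_grpo (R : realType) (theta : R) (G : nat)
    (y : 'I_G -> bool) : R :=
  grpo_update (fun i => (y i)%:R) (fun i => score theta (y i)).

Definition num_correct (G : nat) (y : 'I_G -> bool) : nat :=
  (\sum_(i < G) y i)%N.

(* Main.v *)
(* The log-likelihood of a response is [- ln (1 + e^-t) - (1 - b) t], so the
   score is the reward minus the constant [p].  Deviations from the group mean
   sum to zero, so that constant is immaterial and the update is
   [sum_i (R_i - mu)^2 / (G sigma) = sigma], the standard deviation of [k] ones
   among [G] bits.  By independence the set of correct responses equals a given
   [S] with probability [p^|S| (1-p)^(G-|S|)], whence the binomial law of [k],
   against which [sigma] is integrated. *)
Require Import Defs.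
From mathcomp Require Import all_boot all_order all_algebra.
From mathcomp Require Import all_classical all_reals all_analysis.
From mathcomp Require Import ring.
Import Order.TTheory GRing.Theory Num.Theory.
Import numFieldNormedType.Exports.
Local Open Scope classical_set_scope.
Local Open Scope ring_scope.

Set Implicit Arguments.
Unset Strict Implicit.
Unset Printing Implicit Defensive.

Lemma sigmoidC (R : realType) (t : R) :
  1 - sigmoid t = expR (- t) * sigmoid t.
Proof.
have h : 1 + expR (- t) != 0 by rewrite gt_eqF// ltr_pwDl// expR_ge0.
by rewrite /sigmoid; field.
Qed.

(** A single formula for both responses, so that [scoreE] differentiates once for all [b]. *)
Lemma ln_logit_policy (R : realType) (t : R) (b : bool) :
  ln (logit_policy t b) = - ln (1 + expR (- t)) - (~~ b)%:R * t.
Proof.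
have h : 0 < 1 + expR (- t) by rewrite ltr_pwDl// expR_ge0.
have hs : ln (sigmoid t) = - ln (1 + expR (- t)) by rewrite lnV ?posrE.
rewrite /logit_policy /bernoulli_pmf; case: b => /=.
  by rewrite hs mul0r subr0.
by rewrite sigmoidC lnM ?posrE ?expR_gt0 ?invr_gt0// hs expRK mul1r addrC.
Qed.

Lemma scoreE (R : realType) (t : R) (b : bool) : score t b = b%:R - sigmoid t.
Proof.
rewrite /score (funext (fun x => ln_logit_policy x b)) derive1E.
have h : 0 < 1 + expR (- t) by rewrite ltr_pwDl// expR_ge0.
have d1 : is_derive t (1 : R) (fun x : R => 1 + expR (- x)) (- expR (- t)).
  have d0 : is_derive t (1 : R) (expR \o -%R) (- expR (- t)).
    by apply: is_derive_eq; rewrite /= mulrN1.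
  rewrite -[X in is_derive _ _ _ X]add0r; exact: is_deriveD.
have d2 : is_derive t (1 : R) (@ln R \o (fun x : R => 1 + expR (- x)))
   ((1 + expR (- t))^-1 * - expR (- t)).
  have dln := is_derive1_ln h.
  by apply: is_derive_eq; rewrite mulrC.
have d3 : is_derive t (1 : R)
   (fun x : R => - ln (1 + expR (- x)) - (~~ b)%:R * x)
   (- ((1 + expR (- t))^-1 * - expR (- t)) - (~~ b)%:R).
  by apply: is_derive_eq; rewrite /GRing.scale/= mulr1.
(* Up to unfolding [sigmoid], the logarithmic term contributes $e^{-t}\,\mathrm{sigmoid}(t)$, which
   is [1 - sigmoid t]. *)
rewrite derive_val mulrN opprK mulrC -sigmoidC.
by case: b {d3} => /=; ring.
Qed.

Section grpo.
Variables (R : realType) (G : nat).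
Implicit Types (r s : 'I_G -> R) (y : 'I_G -> bool).

Lemma sum_group_deviation r : \sum_(i < G) (r i - group_mean r) = 0.
Proof.
have [G0|G0] := posnP G.
  by rewrite big1// => i; have := ltn_ord i; rewrite [X in (_ < X)%N]G0.
rewrite sumrB sumr_const card_ord -mulr_natl /group_mean mulrA divff.
  by rewrite mul1r subrr.
by rewrite pnatr_eq0 -lt0n.
Qed.

Lemma grpo_update_shift r s (c : R) :
  (forall i, s i = r i - c) -> grpo_update r s = group_std r.
Proof.
move=> sE; rewrite /grpo_update; under eq_bigr do rewrite sE.
(* When the deviation is zero, all advantages are zero by convention and both sides vanish. *)
rewrite /advantage; case: (eqVneq (group_std r) 0) => [->|sd0].
  by rewrite big1 ?mulr0// => i _; rewrite mul0r.
(* Here $r_i - c = (r_i - \mu) + (\mu - c)$; the second part yields a multiple of the sum of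
   deviations, hence zero. *)
rewrite (eq_bigr (fun i => ((r i - group_mean r) ^+ 2
    + (group_mean r - c) * (r i - group_mean r)) / group_std r)); last first.
  by move=> i _; ring.
rewrite -mulr_suml big_split/= -mulr_sumr sum_group_deviation mulr0 addr0 mulrA.
set v := G%:R^-1 * _.
have v0 : 0 <= v.
  by rewrite mulr_ge0 ?invr_ge0// sumr_ge0// => i _; rewrite sqr_ge0.
by rewrite -[v in LHS]sqr_sqrtr// -/(group_std r) expr2 mulfK.
Qed.

Lemma num_correct_le y : (num_correct y <= G)%N.
Proof.
by rewrite -[leqRHS]card_ord -sum1_card leq_sum// => i _; case: (y i).
Qed.

Lemma group_std_bool y : (0 < G)%N ->
  group_std (fun i => (y i)%:R : R) =
  Num.sqrt ((num_correct y * (G - num_correct y))%N)%:R / G%:R.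
Proof.
move=> G0; have G0' : G%:R != 0 :> R by rewrite pnatr_eq0 -lt0n.
have sumE : \sum_(i < G) (y i)%:R = (num_correct y)%:R :> R by rewrite -natr_sum.
rewrite /group_std.
have mE : group_mean (fun i => (y i)%:R : R) = (num_correct y)%:R / G%:R.
  by rewrite /group_mean sumE mulrC.
set k := num_correct y in mE sumE *.
(* A bit equals its own square, so the squared deviation is affine in [y i] and its sum depends only
   on [k]. *)
rewrite mE (eq_bigr (fun i => (1 - 2 * (k%:R / G%:R)) * (y i)%:R
    + (k%:R / G%:R) ^+ 2)); last by move=> i _; case: (y i) => /=; ring.
rewrite big_split/= -mulr_sumr sumE sumr_const card_ord -[_ ^+ 2 *+ _]mulr_natl.
(* The variance is $k/G - (k/G)^2$; the truncated [G - k] is a true difference because [k <= G]. *)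
rewrite [X in Num.sqrt X](_ : _ = (k * (G - k))%N%:R * G%:R^-1 ^+ 2); last first.
  by rewrite natrM natrB ?num_correct_le//; field.
by rewrite sqrtrM ?ler0n// sqrtr_sqr ger0_norm ?invr_ge0.
Qed.
End grpo.

(** Turns the finitely supported sum given by [measure_fin_bigcup] into one that [partition_big] can
    regroup. *)
Lemma fsbig_finType (I : finType) (V : Type) (idx : V)
    (op : Monoid.com_law idx) (A : set I) (F : I -> V) :
  \big[op/idx]_(i \in A) F i = \big[op/idx]_(i | i \in A) F i.
Proof.
rewrite fsbig_mkcond (fsbigE (index_enum I))//.
- by rewrite [RHS]big_mkcond/=; apply: eq_bigl => i; rewrite in_setT.
- exact: index_enum_uniq.
- by move=> i _; rewrite mem_index_enum.
Qed.

Lemma num_correct_card (G : nat) (y : 'I_G -> bool) :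
  num_correct y = #|[set i | y i]%SET|.
Proof.
rewrite /num_correct -sum1dep_card [RHS]big_mkcond/=.
by apply: eq_bigr => i _; case: (y i).
Qed.

Section law.
Context {R : realType} {d : measure_display} {T : measurableType d}.
Variables (P : probability T R) (G : nat) (p : R).
Variable y : 'I_G -> {RV P >-> bool}.

Let correct (w : T) : {set 'I_G} := [set i | y i w]%SET.

(** Fixing the set of correct responses prescribes every bit, which gives an intersection of the
    shape required by [mutually_independent]. *)
Lemma correct_set1 (S : {set 'I_G}) : correct @^-1` [set S] =
  \bigcap_(i in [set` [set: 'I_G]%SET]) (y i @^-1` [set i \in S]).
Proof.
apply/seteqP; split=> w /=.
  by move=> <- i _ /=; rewrite inE.
by move=> h; apply/setP => i; rewrite inE (h i)//= inE.
Qed.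

Lemma measurable_correct_set1 (S : {set 'I_G}) :
  measurable (correct @^-1` [set S]).
Proof.
rewrite correct_set1; apply: fin_bigcap_measurable => // i _.
by rewrite -[X in measurable X]setTI; exact: measurable_funP.
Qed.

(** The count factors through the finite-valued map [correct]; this finite decomposition yields both
    its measurability and its law. *)
Lemma num_correct_preimage (U : set nat) :
  (fun w => num_correct (fun i => y i w)) @^-1` U =
  \bigcup_(S in [set S : {set 'I_G} | U #|S|]) (correct @^-1` [set S]).
Proof.
apply/seteqP; split=> w /=; rewrite num_correct_card.
  by move=> Uw; exists (correct w).
by move=> [S /= US E]; rewrite -E in US.
Qed.

Lemma measurable_num_correct :
  measurable_fun [set: T] (fun w => num_correct (fun i => y i w)).
Proof.
move=> _ U _; rewrite setTI num_correct_preimage.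
apply: fin_bigcup_measurable => // S _; exact: measurable_correct_set1.
Qed.

Hypothesis p01 : 0 <= p <= 1.
Hypothesis y_indep : mutually_independent y.
Hypothesis y_law : forall i, distribution P (y i) = bernoulli_prob p.

Lemma prob_correct_set1 (S : {set 'I_G}) :
  P (correct @^-1` [set S]) = (p ^+ #|S| * (1 - p) ^+ (G - #|S|))%:E.
Proof.
rewrite correct_set1 (y_indep _ (A := fun i => [set i \in S]))//.
have yE (i : 'I_G) b : P (y i @^-1` [set b]) = (bernoulli_pmf p b)%:E.
  rewrite -[LHS]/(distribution P (y i) [set b]) y_law.
  by rewrite /bernoulli_prob p01 fsbig_set1.
under eq_bigr do rewrite yE.
rewrite prodEFin; congr EFin.
rewrite (eq_bigl predT) => [|i]; last by rewrite inE.
(* Indices in [S] contribute [p] each, and the [G - #|S|] others [1 - p] each. *)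
rewrite (bigID (mem S))/=.
rewrite (eq_bigr (fun=> p)) => [|i iS]; last by rewrite /bernoulli_pmf iS.
rewrite prodr_const; congr (_ * _).
rewrite (eq_bigr (fun=> 1 - p)) => [|i /negbTE iS]; last first.
  by rewrite /bernoulli_pmf iS.
rewrite prodr_const -[X in (X - _)%N]card_ord -(cardC S) addKn.
by congr (_ ^+ _); apply: eq_card => i.
Qed.

Lemma pushforward_num_correct :
  pushforward P (fun w => num_correct (fun i => y i w)) = binomial_prob G p.
Proof.
apply/funext => U; case/andP: (p01) => p0 p1.
rewrite (@binomial_probE _ G p p0 p1) /pushforward num_correct_preimage.
rewrite measure_fin_bigcup//; last first.
- by move=> S _; exact: measurable_correct_set1.
- by move=> S S' _ _ [w [/= <- <-]].
- exact: finite_finset.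
rewrite fsbig_finType (eq_bigr _ (fun S _ => prob_correct_set1 S)).
(* Sets are grouped by size: each of the ['C(G, k)] sets of size [k] has the same probability. *)
rewrite (partition_big (fun S : {set 'I_G} => inord #|S| : 'I_G.+1) predT)//=.
apply: eq_bigr => k _.
rewrite (eq_bigl (fun S : {set 'I_G} =>
    ((k : nat) \in U) && (#|S| == k))); last first.
  move=> S; rewrite -val_eqE/= inordK; last first.
    by rewrite ltnS -[leqRHS]card_ord max_card.
  by case: eqP => [<-|_]; rewrite ?andbF// !andbT;
    apply/idP/idP; rewrite !inE.
rewrite diracE; case: ((k : nat) \in U) => /=; last first.
  by rewrite big_pred0_eq mule0.
rewrite (eq_bigr (fun=> (p ^+ k * (1 - p) ^+ (G - k))%:E)) => [|S /eqP ->//].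
rewrite mule1 sumEFin sumr_const; congr ((_ *+ _)%:E).
by have := card_draws 'I_G k; rewrite card_ord cardsE => <-.
Qed.

End law.

Unset Implicit Arguments.
Set Strict Implicit.
Set Printing Implicit Defensive.

Theorem proposition2 (R : realType) (d : measure_display)
    (T : measurableType d) (P : probability T R)
    (G : nat) (hG : (1 <= G)%N)
    (p : R) (hp : 0 < p < 1)
    (theta : R) (htheta : p = sigmoid theta)
    (y : 'I_G -> {RV P >-> bool})
    (y_indep : mutually_independent y)
    (y_law : forall i : 'I_G, distribution P (y i) = bernoulli_prob p) :
  let k : T -> nat := fun w => num_correct (fun i => y i w) in
  let g : T -> R := fun w => bernoulli_grpo theta (fun i => y i w) in
  [/\ measurable_fun setT k,
      pushforward P k = binomial_prob G p,
      forall w : T, g w = Num.sqrt ((k w * (G - k w))%N)%:R / G%:R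
    & ('E_P[g])%E =
      (G%:R^-1 * \sum_(1 <= j < G)
         'C(G, j)%:R * p ^+ j * (1 - p) ^+ (G - j)
         * Num.sqrt ((j * (G - j))%N)%:R)%:E].
Proof.
move=> k g.
have p01 : 0 <= p <= 1 by case/andP: hp => p0 p1; rewrite !ltW.
have mk : measurable_fun setT k by exact: measurable_num_correct.
have kE : pushforward P k = binomial_prob G p by exact: pushforward_num_correct.
have gE w : g w = Num.sqrt ((k w * (G - k w))%N)%:R / G%:R.
  rewrite -group_std_bool//; apply: (grpo_update_shift (c := sigmoid theta)) => i.
  exact: scoreE.
split=> //.
pose h (j : nat) : \bar R := (Num.sqrt ((j * (G - j))%N)%:R / G%:R)%:E.
have h0 j : (0 <= h j)%E by rewrite lee_fin divr_ge0.
case/andP: (p01) => p0 p1.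
transitivity (\int[P]_w (h (k w)))%E.
  by rewrite unlock; apply: eq_integral => w _; rewrite gE.
(* Change of variables to the law of [k]; nonnegativity of [h] stands in for integrability. *)
have := ge0_integral_pushforward mk P (D := setT) (f := h).
rewrite preimage_setT => <-//.
rewrite (eq_measure_integral (binomial_prob G p)) => [|A _ _]; last first.
  exact: (congr1 (@^~ A) kE).
rewrite (@integral_binomial _ _ _ p0 p1)//.
(* With [G = n.+1] the end terms [j = 0] and [j = G] are distinct; both are peeled off and vanish,
   leaving [1 <= j < G]. *)
case: G hG {y y_indep y_law k g mk kE gE} @h h0 => // n _ h h0.
rewrite big_ord_recl big_ord_recr/=.
rewrite /h mul0n sqrtr0 mul0r mule0 add0e subnn muln0 sqrtr0 mul0r mule0 adde0.
rewrite sumEFin; congr EFin.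
rewrite big_add1 big_mkord big_distrr/=; apply: eq_bigr => i _.
rewrite -mulr_natl; ring.
Qed.
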